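(* Let $G$ be a discrete group. Then every action $(A,\alpha)$ of $G$ on a $C^*$-algebra $A$ is strongly Pedersen rigid.
   Context: Conventions. $C^*(G)$ is the full group $C^*$-algebra of the locally compact group $G$; each $s\in G$ is identified with its canonical unitary in $M(C^*(G))$. Tensor products of $C^*$-algebras are minimal, and nondegenerate homomorphisms into multiplier algebras are extended to multiplier algebras by the same symbol. An action $(A,\alpha)$ of $G$ is a strongly continuous homomorphism $\alpha: G\to \mathrm{Aut}(A)$. $A\rtimes_\alpha G$ is the full crossed product with canonical maps $i_A: A\to M(A\rtimes_\alpha G)$, $i_G: G\to M(A\rtimes_\alpha G)$. The dual coaction $\widehat\alpha: A\rtimes_\alpha G\to M((A\rtimes_\alpha G)\otimes C^*(G))$ is determined by $\widehat\alpha(i_A(a))=i_A(a)\otimes 1$ and $\widehat\alpha(i_G(s))=i_G(s)\otimes s$. Strong Pedersen rigidity. Put $D=A\rtimes_\alpha G$ and $\delta=\widehat\alpha$. An equivariant homomorphism is a strictly continuous unitary homomorphism $V: G\to M(D)$ with $\delta(V_s)=V_s\otimes s$ for all $s\in G$; its integrated form $C^*(G)\to M(D)$ is also denoted $V$. The generalized fixed-point algebra $D^{\delta,V}$ is the set of all $m\in M(D)$ such that (1) $\delta(m)=m\otimes 1$; (2) $mV(f), V(f)m\in D$ for all $f\in C_c(G)$; (3) $s\mapsto V_s m V_s^*$ is norm continuous. The action $(A,\alpha)$ is strongly Pedersen rigid if $D^{\delta,V}=D^{\delta,W}$ for any two equivariant homomorphisms $V,W: G\to M(D)$. *)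

(* Defs.v *)
From HB Require Import structures.
From mathcomp Require Import all_boot all_order all_algebra.
From mathcomp Require Import boolp classical_sets functions cardinality fsbigop.
From mathcomp Require Import reals topology normedtype complex.

Set Implicit Arguments.
Unset Strict Implicit.
Unset Printing Implicit Defensive.

Import Order.TTheory GRing.Theory Num.Theory.
Import numFieldNormedType.Exports.

Local Open Scope classical_set_scope.
Local Open Scope ring_scope.

HB.mixin Record isCStarAlgebra (R : realType) A
    of CompleteNormedModule R[i] A := {
  amul : A -> A -> A;
  adj : A -> A;
  amulA : associative amul;
  amulDl : left_distributive amul +%R;
  amulDr : right_distributive amul +%R;
  amulZl : forall (k : R[i]) (a b : A), amul (k *: a) b = k *: amul a b;
  amulZr : forall (k : R[i]) (a b : A), amul a (k *: b) = k *: amul a b;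
  adjK : involutive adj;
  adjD : {morph adj : a b / a + b};
  adjZ : forall (k : R[i]) (a : A), adj (k *: a) = k^* *: adj a;
  adjM : {morph adj : a b / amul a b >-> amul b a};
  normr_amul : forall a b : A, `|amul a b| <= `|a| * `|b|;
  cstar_identity : forall a : A, `|amul (adj a) a| = `|a| ^+ 2
}.

#[short(type="cstarAlgType")]
HB.structure Definition CStarAlgebra (R : realType) :=
  {A of CompleteNormedModule R[i] A & isCStarAlgebra R A}.

Notation "a ** b" := (amul a b) (at level 40, left associativity) : ring_scope.

Section CStarTheory.
Variables (R : realType) (A : cstarAlgType R).
Implicit Types a b x : A.

Lemma amul0l b : 0 ** b = 0 :> A.
Proof. by rewrite -(scale0r (0 : A)) amulZl !scale0r. Qed.

Lemma amul0r a : a ** 0 = 0 :> A.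
Proof. by rewrite -(scale0r (0 : A)) amulZr !scale0r. Qed.

Lemma amulNl a b : (- a) ** b = - (a ** b).
Proof. by rewrite -scaleN1r amulZl scaleN1r. Qed.

Lemma amulNr a b : a ** (- b) = - (a ** b).
Proof. by rewrite -scaleN1r amulZr scaleN1r. Qed.

Lemma amulBl a b x : (a - b) ** x = a ** x - b ** x.
Proof. by rewrite amulDl amulNl. Qed.

Lemma amulBr a b x : x ** (a - b) = x ** a - x ** b.
Proof. by rewrite amulDr amulNr. Qed.

Lemma adj0 : adj (0 : A) = 0.
Proof. by rewrite -(scale0r (0 : A)) adjZ conjC0 !scale0r. Qed.

Lemma normr_adj a : `|adj a| = `|a|.
Proof.
have adj_ge b : `|b| <= `|adj b|.
  have [->|b0] := eqVneq b 0; first by rewrite normr0.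
  have n0 : 0 < `|b| by rewrite normr_gt0.
  by rewrite -(ler_pM2r n0) -expr2 -cstar_identity normr_amul.
by apply/eqP; rewrite eq_le adj_ge andbT -{2}(adjK a) adj_ge.
Qed.

Lemma amul_eq0P a : adj a ** a = 0 -> a = 0.
Proof.
by move=> h; apply/eqP; rewrite -normr_eq0 -sqrf_eq0 -cstar_identity h normr0.
Qed.

Lemma amul_lcancel a b : (forall x, x ** a = x ** b) -> a = b.
Proof.
move=> h; apply/eqP; rewrite -subr_eq0; apply/eqP/amul_eq0P.
by rewrite amulBr h subrr.
Qed.

Lemma amul_rcancel a b : (forall x, a ** x = b ** x) -> a = b.
Proof.
move=> h; apply: (can_inj (@adjK R A)); apply: amul_lcancel => x.
by rewrite -(adjK x) -!adjM h.
Qed.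

End CStarTheory.

Section OpNorm.
Variables (R : realType) (V : normedModType R[i]).
Implicit Types f : V -> V.

Definition opbounded f := exists M : R[i], forall a, `|f a| <= M * `|a|.

Definition opnorm f : R :=
  sup [set complex.Re `|f a| | a in [set a : V | `|a| <= 1]].

Let normE (x : V) : (complex.Re `|x|)%:C%C = `|x| :> R[i].
Proof. by rewrite RRe_real // normr_real. Qed.

Lemma opbounded_ge0 f : opbounded f ->
  exists M : R, 0 <= M /\ forall a, `|f a| <= M%:C%C * `|a|.
Proof.
move=> [M hM]; exists (complex.Re `|M|); split.
  by rewrite -ler0c RRe_real ?normr_real.
move=> a; rewrite RRe_real ?normr_real //.
rewrite -[leRHS]ger0_norm ?mulr_ge0 // normrM normr_id -normrM.
by rewrite ger0_norm // (le_trans _ (hM a)).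
Qed.

Let has_sup_op f : (forall k a, f (k *: a) = k *: f a) -> opbounded f ->
  has_sup [set complex.Re `|f a| | a in [set a : V | `|a| <= 1]].
Proof.
move=> fZ /opbounded_ge0[M [M0 hM]]; split.
  by exists (complex.Re `|f 0|), 0 => //=; rewrite normr0.
exists M => _ [a /= a1 <-]; rewrite -lecR normE (le_trans (hM a)) //.
by rewrite ler_piMr // ler0c.
Qed.

Lemma opnorm_ub f : (forall k a, f (k *: a) = k *: f a) -> opbounded f ->
  forall a, `|f a| <= (opnorm f)%:C%C * `|a|.
Proof.
move=> fZ fb a; have [->|a0] := eqVneq a 0.
  have -> : f 0 = 0 by have := fZ 0 0; rewrite !scale0r.
  by rewrite normr0 mulr0.
have n0 : 0 < `|a| by rewrite normr_gt0.
rewrite -ler_pdivrMr // mulrC -{1}(@ger0_norm _ `|a|^-1) ?invr_ge0 //.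
rewrite -normrZ -fZ -(normE (f _)) lecR; apply: sup_upper_bound; first exact: has_sup_op.
exists (`|a|^-1 *: a) => //=.
by rewrite normrZ ger0_norm ?invr_ge0 // mulVf ?gt_eqF.
Qed.

Lemma opnorm_lub f (M : R[i]) : 0 <= M ->
  (forall a, `|f a| <= M * `|a|) -> (opnorm f)%:C%C <= M.
Proof.
move=> M0 hM; rewrite -(RRe_real (ger0_real M0)) lecR; apply: sup_le_ub.
  by exists (complex.Re `|f 0|), 0 => //=; rewrite normr0.
move=> _ [a /= a1 <-]; rewrite -lecR normE RRe_real ?ger0_real //.
by rewrite (le_trans (hM a)) // ler_piMr.
Qed.

End OpNorm.

(* A double centralizer: mL x stands for m x and mR x for x m. *)
Record multiplier (R : realType) (A : cstarAlgType R) := Multiplier {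
  mL : A -> A;
  mR : A -> A;
  mL_linear : linear mL;
  mR_linear : linear mR;
  mL_bounded : opbounded mL;
  mR_bounded : opbounded mR;
  mLM : forall a b, mL (a ** b) = mL a ** b;
  mRM : forall a b, mR (a ** b) = a ** mR b;
  mLR : forall a b, a ** mL b = mR a ** b
}.

Section MultiplierOps.
Variables (R : realType) (A : cstarAlgType R).
Implicit Types (m n : multiplier A) (a b : A) (k : R[i]).

Lemma mult_ext m n : mL m =1 mL n -> m = n.
Proof.
move=> e; have eL : mL m = mL n by apply/funext.
have eR : mR m = mR n.
  by apply/funext => a; apply: amul_rcancel => b; rewrite -!mLR e.
case: m n eL eR {e} => [L r ? ? ? ? ? ? ?] [L' r' ? ? ? ? ? ? ?] /= eL eR.
by subst L' r'; congr Multiplier; exact: Prop_irrelevance.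
Qed.

Lemma mLD m a b : mL m (a + b) = mL m a + mL m b.
Proof. by have := mL_linear m 1 a b; rewrite !scale1r. Qed.

Lemma mL0 m : mL m 0 = 0.
Proof. by have := mL_linear m (-1) 0 0; rewrite !scaleN1r oppr0 addr0 addNr. Qed.

Lemma mLZ m k a : mL m (k *: a) = k *: mL m a.
Proof. by have := mL_linear m k a 0; rewrite !(mL0, addr0). Qed.

Lemma mRD m a b : mR m (a + b) = mR m a + mR m b.
Proof. by have := mR_linear m 1 a b; rewrite !scale1r. Qed.

Lemma mR0 m : mR m 0 = 0.
Proof. by have := mR_linear m (-1) 0 0; rewrite !scaleN1r oppr0 addr0 addNr. Qed.

Lemma mRZ m k a : mR m (k *: a) = k *: mR m a.
Proof. by have := mR_linear m k a 0; rewrite !(mR0, addr0). Qed.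

Section Build.
Variables (L r : A -> A) (Lr : forall a b, a ** L b = r a ** b).
Variable (M : R[i]).
Hypothesis LM : forall a, `|L a| <= M * `|a|.

Let Llin : linear L.
Proof.
move=> k a b; apply: amul_lcancel => x.
by rewrite Lr amulDr !amulDr !amulZr !Lr.
Qed.

Let rlin : linear r.
Proof.
move=> k a b; apply: amul_rcancel => x.
by rewrite -Lr amulDl !amulZl !amulDl !amulZl -!Lr.
Qed.

Let Lmul a b : L (a ** b) = L a ** b.
Proof. by apply: amul_lcancel => x; rewrite Lr !amulA Lr. Qed.

Let rmul a b : r (a ** b) = a ** r b.
Proof. by apply: amul_rcancel => x; rewrite -Lr -!amulA Lr. Qed.

Let rb : opbounded r.
Proof.
exists M => a; have [->|ra0] := eqVneq (r a) 0.
  have [->|a0] := eqVneq a 0; first by rewrite !normr0 mulr0.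
  by rewrite normr0 (le_trans _ (LM a)).
have n0 : 0 < `|r a| by rewrite normr_gt0.
rewrite -(ler_pM2r n0) -expr2 -(normr_adj (r a)) -cstar_identity adjK -Lr.
rewrite (le_trans (normr_amul _ _)) // [M * _]mulrC -mulrA ler_wpM2l //.
Qed.

Definition mkmult : multiplier A :=
  Multiplier Llin rlin (ex_intro _ M LM) rb Lmul rmul Lr.

End Build.

Definition mnorm m : R := opnorm (mL m).

Lemma mnorm_ub m a : `|mL m a| <= (mnorm m)%:C%C * `|a|.
Proof. by apply: opnorm_ub; [exact: mLZ|exact: mL_bounded]. Qed.

Lemma mnorm_lub m (M : R[i]) : 0 <= M ->
  (forall a, `|mL m a| <= M * `|a|) -> (mnorm m)%:C%C <= M.
Proof. exact: opnorm_lub. Qed.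

Lemma mnorm_ge0 m : 0 <= (mnorm m)%:C%C :> R[i].
Proof.
have [a0|/existsNP[a /eqP a0]] := pselect (forall a : A, a = 0).
  rewrite ler0c; suff -> : mnorm m = 0 by [].
  rewrite /mnorm /opnorm (_ : [set _ | _ in _] = [set 0]) ?sup1 //.
  apply/seteqP; split => [_ [a _ <-]|_ ->] /=; first by rewrite (a0 (mL m a)) normr0.
  by exists 0 => /=; rewrite ?mL0 normr0.
have n0 : 0 < `|a| by rewrite normr_gt0.
by rewrite -(pmulr_lge0 _ n0) (le_trans _ (mnorm_ub m a)).
Qed.

Fact mult0_LR a b : a ** 0 = 0 ** b :> A.
Proof. by rewrite amul0l amul0r. Qed.
Fact mult0_bd a : `|0 : A| <= 0 * `|a|.
Proof. by rewrite normr0 mul0r. Qed.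
Definition mult0 := @mkmult (fun=> 0) (fun=> 0) mult0_LR 0 mult0_bd.

Fact mult1_LR a b : a ** b = a ** b. Proof. by []. Qed.
Fact mult1_bd a : `|a| <= 1 * `|a|. Proof. by rewrite mul1r. Qed.
Definition mone := @mkmult id id mult1_LR 1 mult1_bd.

Fact multD_LR m n a b : a ** (mL m b + mL n b) = (mR m a + mR n a) ** b.
Proof. by rewrite amulDr amulDl !mLR. Qed.
Fact multD_bd m n a :
  `|mL m a + mL n a| <= ((mnorm m)%:C%C + (mnorm n)%:C%C) * `|a|.
Proof.
by rewrite mulrDl (le_trans (ler_normD _ _)) // lerD // mnorm_ub.
Qed.
Definition multD m n := mkmult (multD_LR m n) (multD_bd m n).

Fact multZ_LR k m a b : a ** (k *: mL m b) = (k *: mR m a) ** b.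
Proof. by rewrite amulZr amulZl mLR. Qed.
Fact multZ_bd k m a : `|k *: mL m a| <= (`|k| * (mnorm m)%:C%C) * `|a|.
Proof. by rewrite normrZ -mulrA ler_wpM2l // mnorm_ub. Qed.
Definition multZ k m := mkmult (multZ_LR k m) (multZ_bd k m).

Fact multM_LR m n a b : a ** mL m (mL n b) = mR n (mR m a) ** b.
Proof. by rewrite !mLR. Qed.
Fact multM_bd m n a :
  `|mL m (mL n a)| <= ((mnorm m)%:C%C * (mnorm n)%:C%C) * `|a|.
Proof.
by rewrite (le_trans (mnorm_ub _ _)) // -mulrA ler_wpM2l ?mnorm_ge0 ?mnorm_ub.
Qed.
Definition multM m n := mkmult (multM_LR m n) (multM_bd m n).

Fact madj_LR m a b : a ** adj (mR m (adj b)) = adj (mL m (adj a)) ** b.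
Proof. by apply: (can_inj (@adjK R A)); rewrite !adjM !adjK mLR. Qed.
Fact madj_bd m : exists M, forall a, `|adj (mR m (adj a))| <= M * `|a|.
Proof.
by have [M hM] := mR_bounded m; exists M => a; rewrite normr_adj -(normr_adj a).
Qed.
Definition madj m := mkmult (madj_LR m) (projT2 (cid (madj_bd m))).

Fact emb_LR x a b : a ** (x ** b) = (a ** x) ** b.
Proof. by rewrite amulA. Qed.
Definition emb x := mkmult (emb_LR x) (normr_amul x).

End MultiplierOps.

Section MultiplierInstances.
Variables (R : realType) (A : cstarAlgType R).
Local Notation MA := (multiplier A).

HB.instance Definition _ := gen_eqMixin MA.
HB.instance Definition _ := gen_choiceMixin MA.

Fact multDA : associative (@multD R A).
Proof. by move=> m n p; apply: mult_ext => a /=; rewrite addrA. Qed.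
Fact multDC : commutative (@multD R A).
Proof. by move=> m n; apply: mult_ext => a /=; rewrite addrC. Qed.
Fact mult0D : left_id (mult0 A) (@multD R A).
Proof. by move=> m; apply: mult_ext => a /=; rewrite add0r. Qed.
Fact multND : left_inverse (mult0 A) (multZ (-1)) (@multD R A).
Proof. by move=> m; apply: mult_ext => a /=; rewrite scaleN1r addNr. Qed.
HB.instance Definition _ :=
  GRing.isZmodule.Build MA multDA multDC mult0D multND.

Fact multZA (k l : R[i]) (m : MA) : multZ k (multZ l m) = multZ (k * l) m.
Proof. by apply: mult_ext => a /=; rewrite scalerA. Qed.
Fact multZ1 : left_id 1 (@multZ R A).
Proof. by move=> m; apply: mult_ext => a /=; rewrite scale1r. Qed.
Fact multZDr : right_distributive (@multZ R A) +%R.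
Proof. by move=> k m n; apply: mult_ext => a /=; rewrite scalerDr. Qed.
Fact multZDl (m : MA) : {morph (@multZ R A)^~ m : k l / k + l}.
Proof. by move=> k l; apply: mult_ext => a /=; rewrite scalerDl. Qed.
HB.instance Definition _ :=
  GRing.Zmodule_isLmodule.Build R[i] MA multZA multZ1 multZDr multZDl.

Fact mnormD (m n : MA) :
  (mnorm (m + n))%:C%C <= (mnorm m)%:C%C + (mnorm n)%:C%C :> R[i].
Proof. by apply: mnorm_lub; [rewrite addr_ge0 ?mnorm_ge0|exact: multD_bd]. Qed.

Fact mnormZ (k : R[i]) (m : MA) :
  (mnorm (k *: m))%:C%C = `|k| * (mnorm m)%:C%C :> R[i].
Proof.
have le (l : R[i]) (n : MA) : (mnorm (l *: n))%:C%C <= `|l| * (mnorm n)%:C%C.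
  by apply: mnorm_lub; [rewrite mulr_ge0 ?mnorm_ge0|exact: multZ_bd].
apply/eqP; rewrite eq_le le /=; have [->|k0] := eqVneq k 0.
  by rewrite normr0 mul0r mnorm_ge0.
have nk : 0 < `|k| by rewrite normr_gt0.
rewrite -ler_pdivlMl // -normfV.
by have := le k^-1 (k *: m); rewrite scalerA mulVf // scale1r.
Qed.

Fact mnorm0_eq0 (m : MA) : (mnorm m)%:C%C = 0 :> R[i] -> m = 0.
Proof.
move=> m0; apply: mult_ext => a; apply/eqP; rewrite -normr_le0.
by rewrite (le_trans (mnorm_ub m a)) // m0 mul0r.
Qed.

HB.instance Definition _ :=
  Lmodule_isNormed.Build R[i] MA mnormD mnormZ mnorm0_eq0.

Lemma norm_mL (m : MA) a : `|mL m a| <= `|m| * `|a|.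
Proof. exact: mnorm_ub. Qed.

Lemma norm_mult_lub (m : MA) (M : R[i]) : 0 <= M ->
  (forall a, `|mL m a| <= M * `|a|) -> `|m| <= M.
Proof. exact: mnorm_lub. Qed.

Lemma norm_mR (m : MA) a : `|mR m a| <= `|m| * `|a|.
Proof.
have [->|ra0] := eqVneq (mR m a) 0; first by rewrite normr0 mulr_ge0.
have n0 : 0 < `|mR m a| by rewrite normr_gt0.
rewrite -(ler_pM2r n0) -expr2 -(normr_adj (mR m a)) -cstar_identity adjK -mLR.
rewrite (le_trans (normr_amul _ _)) // [`|m| * _]mulrC -mulrA ler_wpM2l //.
by rewrite norm_mL.
Qed.

Let lim_dist (F : set_system MA) (f : MA -> A) x l (C : R[i]) :
  ProperFilter F -> 0 <= C -> f @ F --> l ->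
  (\forall n \near F, `|x - f n| <= C) -> `|x - l| <= C.
Proof.
move=> FF C0 fl fC; rewrite real_leNgt ?normr_real ?ger0_real //.
apply/negP => lt; have e0 : 0 < `|x - l| - C by rewrite subr_gt0.
have /cvgrPdistC_lt/(_ _ e0) fe := fl.
have [n [/= nC ne]] := filter_ex (filterI fC fe).
suff: `|x - l| < `|x - l| by rewrite ltxx.
rewrite (le_lt_trans (ler_distD (f n) _ _)) //.
by rewrite -[ltRHS](subrK C) addrC ltr_leD.
Qed.

Let cauchy_pointwise (F : set_system MA) (f : MA -> A) (c : R[i]) :
  ProperFilter F -> cauchy F -> 0 <= c ->
  (forall m n, `|f m - f n| <= `|m - n| * c) -> cvg (f @ F).
Proof.
move=> FF /cauchy_ballP Fc c0 fc; apply: cauchy_cvg; apply/cauchy_ballP => e e0.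
have c1 : 0 < 1 + c by rewrite ltr_pwDl.
have /= Fe := Fc (e / (1 + c)) (divr_gt0 e0 c1).
rewrite near_map2; apply: filterS Fe => -[m n] /=; rewrite -!ball_normE /= => mn.
rewrite (le_lt_trans (fc _ _)) //.
rewrite (@le_lt_trans _ _ (`|m - n| * (1 + c))) ?ler_wpM2l ?lerDr //.
by rewrite -ltr_pdivlMr.
Qed.

Let cvg_amull (F : set_system MA) (f : MA -> A) a l :
  ProperFilter F -> f @ F --> l -> (fun m => a ** f m) @ F --> a ** l.
Proof.
move=> FF fl; apply/cvgrPdist_lt => e e0.
have c1 : 0 < 1 + `|a| by rewrite ltr_pwDl.
have /cvgrPdist_lt/(_ _ (divr_gt0 e0 c1)) := fl.
apply: filterS => m h; rewrite -amulBr (le_lt_trans (normr_amul _ _)) //.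
rewrite mulrC (@le_lt_trans _ _ (`|l - f m| * (1 + `|a|))) ?ler_wpM2l ?lerDr //.
by rewrite -ltr_pdivlMr.
Qed.

Let cvg_amulr (F : set_system MA) (f : MA -> A) a l :
  ProperFilter F -> f @ F --> l -> (fun m => f m ** a) @ F --> l ** a.
Proof.
move=> FF fl; apply/cvgrPdist_lt => e e0.
have c1 : 0 < 1 + `|a| by rewrite ltr_pwDl.
have /cvgrPdist_lt/(_ _ (divr_gt0 e0 c1)) := fl.
apply: filterS => m h; rewrite -amulBl (le_lt_trans (normr_amul _ _)) //.
rewrite (@le_lt_trans _ _ (`|l - f m| * (1 + `|a|))) ?ler_wpM2l ?lerDr //.
by rewrite -ltr_pdivlMr.
Qed.

Fact mult_complete (F : set_system MA) : ProperFilter F -> cauchy F -> cvg F.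
Proof.
move=> FF Fc.
have mLB (m n : MA) a : mL m a - mL n a = mL (m - n) a by rewrite /= scaleN1r.
have mRB (m n : MA) a : mR m a - mR n a = mR (m - n) a by rewrite /= scaleN1r.
have cvL a : cvg ((fun m => mL m a) @ F).
  by apply: (@cauchy_pointwise _ _ `|a|) => // m n; rewrite mLB norm_mL.
have cvR a : cvg ((fun m => mR m a) @ F).
  by apply: (@cauchy_pointwise _ _ `|a|) => // m n; rewrite mRB norm_mR.
pose L a := lim ((fun m => mL m a) @ F); pose r a := lim ((fun m => mR m a) @ F).
have Lr a b : a ** L b = r a ** b.
  apply: (@cvg_unique _ (@norm_hausdorff _ _) ((fun m => a ** mL m b) @ F)).
    exact: cvg_amull (cvL b).
  have -> : (fun m => a ** mL m b) = (fun m => mR m a ** b).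
    by apply/funext => m; exact: mLR.
  exact: cvg_amulr (cvR a).
have close (e : R[i]) : 0 < e ->
    \forall m \near F, forall a, `|mL m a - L a| <= e * `|a|.
  move=> e0; have /cauchy_ballP/(_ e e0) Fe := Fc.
  apply: filterS (nearP_dep Fe) => m mF a.
  have ea0 : 0 <= e * `|a| by rewrite mulr_ge0 // ltW.
  apply: (lim_dist FF ea0 (cvL a)).
  apply: filterS mF => n; rewrite -ball_normE /= => /ltW mn.
  by rewrite mLB (le_trans (norm_mL _ _)) // ler_wpM2r.
have [m0 m0L] := filter_ex (close 1 ltr01).
have Lb a : `|L a| <= (1 + `|m0|) * `|a|.
  rewrite mulrDl -{1}(subrK (mL m0 a) (L a)) (le_trans (ler_normD _ _)) //.
  by rewrite distrC lerD ?norm_mL.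
apply/cvg_ex; exists (mkmult Lr Lb); apply/cvgrPdist_le => e e0.
near=> m; rewrite distrC; apply: norm_mult_lub; first exact: ltW.
by move=> a; rewrite -mLB; move: a; near: m; exact: close.
Unshelve. all: by end_near. Qed.

HB.instance Definition _ := Uniform_isComplete.Build MA mult_complete.

Fact multMA : associative (@multM R A).
Proof. by move=> m n p; apply: mult_ext. Qed.
Fact multMDl : left_distributive (@multM R A) +%R.
Proof. by move=> m n p; apply: mult_ext. Qed.
Fact multMDr : right_distributive (@multM R A) +%R.
Proof. by move=> m n p; apply: mult_ext => a /=; rewrite mLD. Qed.
Fact multMZl (k : R[i]) (m n : MA) : multM (k *: m) n = k *: multM m n.
Proof. exact: mult_ext. Qed.
Fact multMZr (k : R[i]) (m n : MA) : multM m (k *: n) = k *: multM m n.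
Proof. by apply: mult_ext => a /=; rewrite mLZ. Qed.
Fact madjK : involutive (@madj R A).
Proof. by move=> m; apply: mult_ext => a /=; rewrite !adjK. Qed.
Fact madjD : {morph @madj R A : m n / m + n}.
Proof. by move=> m n; apply: mult_ext => a /=; rewrite adjD. Qed.
Fact madjZ (k : R[i]) (m : MA) : madj (k *: m) = k^* *: madj m.
Proof. by apply: mult_ext => a /=; rewrite adjZ. Qed.
Fact madjM : {morph @madj R A : m n / multM m n >-> multM n m}.
Proof. by move=> m n; apply: mult_ext => a /=; rewrite adjK. Qed.
Fact norm_multM (m n : MA) : `|multM m n| <= `|m| * `|n|.
Proof. by apply: norm_mult_lub; [rewrite mulr_ge0|exact: multM_bd]. Qed.
Fact mult_cstar (m : MA) : `|multM (madj m) m| = `|m| ^+ 2.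
Proof.
have norm_le (n : MA) : `|n| ^+ 2 <= `|multM (madj n) n|.
  set M := `|multM _ _|; have M0 : 0 <= M by exact: normr_ge0.
  rewrite -(sqrtCK M) ler_sqr ?nnegrE ?sqrtC_ge0 //.
  apply: norm_mult_lub; rewrite ?sqrtC_ge0 // => a.
  rewrite -ler_sqr ?nnegrE ?mulr_ge0 ?sqrtC_ge0 // exprMn sqrtCK.
  have e : adj (mL n a) ** mL n a = adj a ** mL (multM (madj n) n) a.
    by rewrite -[RHS]/(adj a ** mL (madj n) (mL n a)) [RHS]mLR /= adjK.
  rewrite -cstar_identity e.
  rewrite (le_trans (normr_amul _ _)) // normr_adj expr2 mulrCA ler_wpM2l //.
  exact: norm_mL.
have norm_adj_ge (n : MA) : `|n| <= `|madj n|.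
  have [->|n0] := eqVneq `|n| 0; first exact: normr_ge0.
  have np : 0 < `|n| by rewrite lt_def n0 normr_ge0.
  by rewrite -(ler_pM2r np) -expr2 (le_trans (norm_le n)) // norm_multM.
apply/eqP; rewrite eq_le norm_le andbT expr2 (le_trans (norm_multM _ _)) //.
by rewrite ler_wpM2r // -{2}(madjK m) norm_adj_ge.
Qed.

HB.instance Definition _ := isCStarAlgebra.Build R MA multMA multMDl multMDr
  multMZl multMZr madjK madjD madjZ madjM norm_multM mult_cstar.

End MultiplierInstances.

HB.structure Definition DiscreteGroup :=
  {G of Group G & DiscreteTopology G}.
Notation discreteGroupType := DiscreteGroup.type.

Definition cspan (R : realType) (V : lmodType R[i]) (S : set V) : set V :=
  [set v | exists2 l : seq (R[i] * V),
     {in l, forall u, S u.2} & v = \sum_(u <- l) u.1 *: u.2].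

Section Homomorphisms.
Variable R : realType.
Implicit Types A B : cstarAlgType R.

Definition star_hom A B (phi : A -> B) : Prop :=
  [/\ linear phi, {morph phi : a b / a ** b} & {morph phi : a / adj a}].

Definition nondegenerate A B (phi : A -> multiplier B) : Prop :=
  dense (cspan [set b | exists a x, b = mL (phi a) x]).

(* A nondegenerate homomorphism A -> M(B) is represented by its extension
   Phi : M(A) -> M(B), which it determines and which is strictly continuous and
   unital: Phi m ** Phi (emb a) = Phi (emb (mL m a)). *)
Definition nondegenerate_hom A B (Phi : multiplier A -> multiplier B) : Prop :=
  star_hom Phi /\ nondegenerate (fun a => Phi (emb a)).

End Homomorphisms.

Section UnitaryHomomorphisms.
Variables (R : realType) (G : discreteGroupType).
Implicit Types A B : cstarAlgType R.

Definition strictly_continuous B (U : G -> multiplier B) : Prop :=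
  forall b, continuous (fun s => mL (U s) b) /\
            continuous (fun s => mR (U s) b).

Definition unitary_hom B (U : G -> multiplier B) : Prop :=
  [/\ forall s, adj (U s) ** U s = mone B,
      forall s, U s ** adj (U s) = mone B
    & {morph U : s t / (s * t)%g >-> s ** t}].

(* C_c(G): in a discrete group the compact sets are the finite ones. *)
Definition Cc : set (G -> R[i]) := [set f | finite_set [set s | f s != 0]].

(* Restriction to C_c(G) of the integrated form of U; the Haar measure of a
   discrete group is taken to be the counting measure. *)
Definition integrated B (U : G -> multiplier B) (f : G -> R[i]) :
  multiplier B := \sum_(s \in [set: G]) f s *: U s.

Record action A := Action {
  act :> G -> A -> A;
  act_hom : forall s, star_hom (act s);
  act1 : forall a, act 1%g a = a;
  actM : forall s t a, act (s * t)%g a = act s (act t a);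
  act_continuous : forall a, continuous (fun s => act s a)
}.

Record covariant A (alpha : action A) B
    (pi : A -> multiplier B) (U : G -> multiplier B) : Prop := Covariant {
  cov_hom : star_hom pi;
  cov_nondegenerate : nondegenerate pi;
  cov_unitary : unitary_hom U;
  cov_continuous : strictly_continuous U;
  cov_eq : forall s a, pi (alpha s a) = U s ** pi a ** adj (U s)
}.

(* The homomorphism Phi of cp_universal is unique, by cp_dense. *)
Record crossed_product A (alpha : action A) := CrossedProduct {
  cp_alg :> cstarAlgType R;
  iA : A -> multiplier cp_alg;
  iG : G -> multiplier cp_alg;
  cp_covariant : covariant alpha iA iG;
  cp_mem : forall a f, Cc f -> exists d, emb d = iA a ** integrated iG f;
  cp_dense : dense (cspan
    [set d | exists a f, Cc f /\ emb d = iA a ** integrated iG f]);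
  cp_universal : forall B (pi : A -> multiplier B) (U : G -> multiplier B),
    covariant alpha pi U ->
    exists Phi : multiplier cp_alg -> multiplier B,
      [/\ nondegenerate_hom Phi, forall a, Phi (iA a) = pi a
        & forall s, Phi (iG s) = U s]
}.

Record group_cstar_algebra := GroupCStarAlgebra {
  gc_alg :> cstarAlgType R;
  gc_u : G -> multiplier gc_alg;
  gc_unitary : unitary_hom gc_u;
  gc_continuous : strictly_continuous gc_u;
  gc_mem : forall f, Cc f -> exists c, emb c = integrated gc_u f;
  gc_dense : dense [set c | exists f, Cc f /\ emb c = integrated gc_u f];
  gc_universal : forall B (U : G -> multiplier B),
    unitary_hom U -> strictly_continuous U ->
    exists Phi : multiplier gc_alg -> multiplier B,
      nondegenerate_hom Phi /\ forall s, Phi (gc_u s) = U s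
}.

End UnitaryHomomorphisms.

HB.mixin Record isHilbert (R : realType) H of CompleteNormedModule R[i] H := {
  inner : H -> H -> R[i];
  inner_linear : forall (k : R[i]) (x y z : H),
    inner (k *: x + y) z = k * inner x z + inner y z;
  inner_conj : forall x y : H, inner y x = (inner x y)^*;
  inner_norm : forall x : H, inner x x = `|x| ^+ 2
}.

#[short(type="hilbertType")]
HB.structure Definition Hilbert (R : realType) :=
  {H of CompleteNormedModule R[i] H & isHilbert R H}.

Section MinimalTensorProduct.
Variable R : realType.
Implicit Types (A B : cstarAlgType R) (H K : hilbertType R).

Record representation A H := Representation {
  rep :> A -> H -> H;
  rep_linear : forall a, linear (rep a);
  rep_bounded : forall a, opbounded (rep a);
  rep_linear_alg : forall x, linear (rep^~ x);
  repM : forall a b x, rep (a ** b) x = rep a (rep b x);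
  rep_adj : forall a x y, inner (rep a x) y = inner x (rep (adj a) y)
}.

Definition faithful A H (pi : representation A H) : Prop :=
  forall a, (forall x, pi a x = 0) -> a = 0.

(* A list v stands for the vector \sum_(u <- v) u.1 (x) u.2 of the algebraic
   tensor product, a dense subspace of the Hilbert space tensor product of H
   and K; sqnorm_tens v is the square of its norm. *)
Definition sqnorm_tens H K (v : seq (H * K)) : R[i] :=
  \sum_(u <- v) \sum_(w <- v) inner u.1 w.1 * inner u.2 w.2.

(* The operator \sum_(c <- t) pi c.1 (x) rho c.2. *)
Definition tens_op A B H K (pi : representation A H) (rho : representation B K)
    (t : seq (A * B)) (v : seq (H * K)) : seq (H * K) :=
  [seq (pi c.1 u.1, rho c.2 u.2) | c <- t, u <- v].

Definition is_spatial_norm A B H K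
    (pi : representation A H) (rho : representation B K)
    (t : seq (A * B)) (N : R[i]) : Prop :=
  let bound M :=
    forall v, sqnorm_tens (tens_op pi rho t v) <= M ^+ 2 * sqnorm_tens v in
  [/\ 0 <= N, bound N & forall M, 0 <= M -> bound M -> N <= M].

(* The spatial norm does not depend on the faithful representations. *)
Record min_tensor A B := MinTensor {
  mt_alg :> cstarAlgType R;
  tens : A -> B -> mt_alg;
  tens_linearl : forall b, linear (tens^~ b);
  tens_linearr : forall a, linear (tens a);
  tensM : forall a a' b b', tens (a ** a') (b ** b') = tens a b ** tens a' b';
  tens_adj : forall a b, tens (adj a) (adj b) = adj (tens a b);
  tens_dense : dense (cspan [set x | exists a b, x = tens a b]);
  tens_norm : exists H K (pi : representation A H) (rho : representation B K),
    [/\ faithful pi, faithful rho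
      & forall t : seq (A * B),
          is_spatial_norm pi rho t `|\sum_(c <- t) tens c.1 c.2| ]
}.

(* z is the image of m (x) n in M(A (x) B); the condition determines z, since
   the elementary tensors span a dense subspace. *)
Definition is_tensor A B (T : min_tensor A B)
    (m : multiplier A) (n : multiplier B) (z : multiplier T) : Prop :=
  forall a b, mL z (tens T a b) = tens T (mL m a) (mL n b) /\
              mR z (tens T a b) = tens T (mR m a) (mR n b).

End MinimalTensorProduct.

Section StrongPedersenRigidity.
Variables (R : realType) (G : discreteGroupType).
Variables (A : cstarAlgType R) (alpha : action G A).

Section DualCoaction.
Variables (D : crossed_product alpha) (C : group_cstar_algebra R G).
Variable T : min_tensor D C.
Variable delta : multiplier D -> multiplier T.

Record dual_coaction : Prop := DualCoaction {
  dc_hom : nondegenerate_hom delta;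
  dc_iA : forall a, is_tensor (iA D a) (mone C) (delta (iA D a));
  dc_iG : forall s, is_tensor (iG D s) (gc_u C s) (delta (iG D s))
}.

Definition equivariant_hom (V : G -> multiplier D) : Prop :=
  [/\ unitary_hom V, strictly_continuous V
    & forall s, is_tensor (V s) (gc_u C s) (delta (V s))].

Definition fixed_point_algebra (V : G -> multiplier D) :
    set (multiplier D) :=
  [set m | [/\ is_tensor m (mone C) (delta m),
     forall f, Cc f -> range (@emb R D) (m ** integrated V f) /\
                       range (@emb R D) (integrated V f ** m)
   & continuous (fun s => V s ** m ** adj (V s))]].

End DualCoaction.

(* The crossed product, C^*(G), the minimal tensor product and the dual
   coaction are unique up to isomorphism; any choice of them is allowed. *)
Definition strongly_pedersen_rigid : Prop :=
  forall (D : crossed_product alpha) (C : group_cstar_algebra R G)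
    (T : min_tensor D C) (delta : multiplier D -> multiplier T),
  dual_coaction delta ->
  forall V W : G -> multiplier D,
    equivariant_hom delta V -> equivariant_hom delta W ->
    fixed_point_algebra delta V = fixed_point_algebra delta W.

End StrongPedersenRigidity.

(* Main.v *)
(* For discrete G the indicator of the identity lies in C_c(G) and integrates
   to 1, so condition (2) says exactly that m lies in D, while condition (3) is
   vacuous. Hence D^{delta,V} = {m in D | delta(m) = m (x) 1} whatever V is. *)

From mathcomp Require Import all_boot all_order all_algebra.
From mathcomp Require Import boolp classical_sets cardinality fsbigop.
Require Import Defs.
From mathcomp Require Import reals topology normedtype complex.

Set Implicit Arguments.
Unset Strict Implicit.
Unset Printing Implicit Defensive.

Import GRing.Theory.

Local Open Scope classical_set_scope.
Local Open Scope ring_scope.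

Section Multipliers.
Variables (R : realType) (B : cstarAlgType R).
Implicit Types (m : multiplier B) (b : B).

Lemma mone_amul m : mone B ** m = m.
Proof. exact: mult_ext. Qed.

Lemma amul_mone m : m ** mone B = m.
Proof. exact: mult_ext. Qed.

(** With [amul_emb], this makes the image of [emb] a two-sided ideal of the multiplier algebra; here
    the double centralizer identity [mLR] moves [m] across the product. *)
Lemma emb_amul b m : emb b ** m = emb (mR m b).
Proof. by apply: mult_ext => x /=; rewrite mLR. Qed.

Lemma amul_emb b m : m ** emb b = emb (mL m b).
Proof. by apply: mult_ext => x /=; rewrite mLM. Qed.

End Multipliers.

Section UnitaryHomomorphisms.
Variables (R : realType) (G : discreteGroupType) (B : cstarAlgType R).
Variable U : G -> multiplier B.
Hypothesis unitaryU : unitary_hom U.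

(** Multiplicativity makes [U 1] idempotent; multiplying by its adjoint cancels one factor. *)
Lemma unitary_hom1 : U 1%g = mone B.
Proof.
case: unitaryU => UU _ UM; have := UM 1%g 1%g; rewrite mul1g => U1.
by rewrite -(UU 1%g) [in X in _ = _ ** X]U1 amulA UU mone_amul.
Qed.

Let indic1 (s : G) : R[i] := (s == 1%g)%:R.

Let Cc_indic1 : Cc indic1.
Proof.
apply: (sub_finite_set _ (finite_set1 (1%g : G))) => s /=.
by rewrite /indic1; case: (s =P 1%g) => // _; rewrite eqxx.
Qed.

Let integrated_indic1 : integrated U indic1 = mone B.
Proof.
(* The sum over the group collapses to its term at the identity. *)
rewrite /integrated -(fsbig_widen [set 1%g]) //.
  by rewrite fsbig_set1 /indic1 eqxx scale1r unitary_hom1.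
by move=> s [_ /= /eqP s1]; rewrite /indic1 (negbTE s1) scale0r.
Qed.

(** Testing on [indic1] recovers [m] itself; conversely, the ideal property keeps both products in
    [B] for every [f]. *)
Lemma integrated_memP m :
  (forall f, Cc f -> range (@emb R B) (m ** integrated U f) /\
                     range (@emb R B) (integrated U f ** m)) <->
  range (@emb R B) m.
Proof.
split=> [/(_ _ Cc_indic1)[]|[b _ <-] f _].
  by rewrite integrated_indic1 amul_mone.
by rewrite emb_amul amul_emb; split; eexists.
Qed.

End UnitaryHomomorphisms.

(** Every preimage is open in a discrete space; this settles the norm continuity of the conjugation
    orbits. *)
Lemma discrete_continuous (X : discreteTopologicalType) (Y : topologicalType)
  (f : X -> Y) : continuous f.
Proof. by apply/continuousP => Z _; exact: discrete_open. Qed.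

Lemma fixed_point_algebraE (R : realType) (G : discreteGroupType)
    (A : cstarAlgType R) (alpha : action G A) (D : crossed_product alpha)
    (C : group_cstar_algebra R G) (T : min_tensor D C)
    (delta : multiplier D -> multiplier T) (V : G -> multiplier D) :
  unitary_hom V ->
  fixed_point_algebra delta V =
    [set m | is_tensor m (mone C) (delta m) /\ range (@emb R D) m].
Proof.
move=> uV; apply/seteqP; split=> m /= [].
  by move=> dm /(integrated_memP uV).
move=> dm /(integrated_memP uV) mV; split=> //.
exact: discrete_continuous.
Qed.

Theorem theorem3p1 (R : realType) (G : discreteGroupType)
    (A : cstarAlgType R) (alpha : action G A) :
  strongly_pedersen_rigid alpha.
Proof.
move=> D C T delta _ V W [uV _ _] [uW _ _].
by rewrite !fixed_point_algebraE.
Qed.
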